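(* For every integer $n\geq 1$, $$\tilde{A}_n(x,y|\alpha)=\sum_{\sigma \in \mathrm{PRW}_{n+1}} (u_1u_2)^{\mathrm{M}(\sigma)}\,u_3^{\mathrm{da}(\sigma)}\,u_4^{\mathrm{dd}(\sigma)}\,\alpha^{\mathrm{LRmin}(\sigma)+\mathrm{RLmin}(\sigma)-2},$$ whenever $x+y=u_3+u_4$ and $xy=u_1u_2$.
   Context: $\mathfrak{S}_n$ is the set of permutations $\sigma=\sigma_1\cdots\sigma_n$ of $[n]=\{1,\dots,n\}$. An index $i\in[n-1]$ is a descent (resp. ascent) of $\sigma$ if $\sigma_i>\sigma_{i+1}$ (resp. $\sigma_i<\sigma_{i+1}$); $\mathrm{des}(\sigma)$ and $\mathrm{asc}(\sigma)$ are the numbers of descents and ascents. $\mathrm{PRW}_n$ is the set of $\pi\in\mathfrak{S}_n$ such that the first ascent (if any) of $\pi$ appears at the letter $1$; i.e., if $\pi$ has an ascent and $i$ is the smallest one, then $\pi_i=1$. A left-to-right minimum (resp. right-to-left minimum) of $\sigma\in\mathfrak{S}_n$ is a letter $\sigma_i$ such that $\sigma_j>\sigma_i$ for every $j<i$ (resp. every $j>i$); $\mathrm{LRmin}(\sigma)$ and $\mathrm{RLmin}(\sigma)$ are the numbers of these. With the convention $\sigma_0=\sigma_{n+1}=+\infty$, a value $\sigma_i$ ($1\le i\le n$) is a double ascent if $\sigma_{i-1}<\sigma_i<\sigma_{i+1}$, a double descent if $\sigma_{i-1}>\sigma_i>\sigma_{i+1}$, and a peak if $\sigma_{i-1}<\sigma_i>\sigma_{i+1}$.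 $\mathrm{da}(\sigma)$, $\mathrm{dd}(\sigma)$, $\mathrm{M}(\sigma)$ denote the numbers of double ascents, double descents, and peaks of $\sigma$, respectively. The binomial-Stirling-Eulerian polynomials are $$\tilde{A}_n(x,y|\alpha)=\sum_{\sigma\in\mathrm{PRW}_{n+1}}x^{\mathrm{des}(\sigma)}y^{\mathrm{asc}(\sigma)}\alpha^{\mathrm{LRmin}(\sigma)+\mathrm{RLmin}(\sigma)-2}.$$ *)

(* Defs.v *)
From HB Require Import structures.
From mathcomp Require Import all_boot all_order all_algebra all_fingroup.

Set Implicit Arguments.
Unset Strict Implicit.
Unset Printing Implicit Defensive.

Import GRing.Theory.

Local Open Scope nat_scope.

(* A permutation s : 'S_n acts on 'I_n = {0, ..., n-1}; [letter s k] is the    *)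
(* k-th letter of the corresponding word s_1 ... s_n on [n] = {1, ..., n}.     *)
(* Outside 1 <= k <= n its value is n.+1, larger than every letter: this       *)
(* plays the role of the convention s_0 = s_(n+1) = +oo.                       *)
Definition letter n (s : 'S_n) (k : nat) : nat :=
  if k is j.+1 then oapp (fun i : 'I_n => (s i).+1) n.+1 (insub j) else n.+1.

Definition is_descent n (s : 'S_n) (i : nat) : bool :=
  (0 < i < n) && (letter s i > letter s i.+1).

Definition is_ascent n (s : 'S_n) (i : nat) : bool :=
  (0 < i < n) && (letter s i < letter s i.+1).

Definition des n (s : 'S_n) : nat := #|[set i : 'I_n | is_descent s i]|.

Definition asc n (s : 'S_n) : nat := #|[set i : 'I_n | is_ascent s i]|.

Definition is_first_ascent n (s : 'S_n) (i : nat) : bool :=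
  is_ascent s i && [forall j : 'I_n, is_ascent s j ==> (i <= j)].

Definition PRW n : {set 'S_n} :=
  [set s : 'S_n |
    [forall i : 'I_n, is_first_ascent s i ==> (letter s i == 1)]].

(* Letters are distinct, so the statistics below count positions; the          *)
(* position i : 'I_n carries the letter s_(i+1).                               *)
Definition LRmin n (s : 'S_n) : nat :=
  #|[set i : 'I_n | [forall j : 'I_n, (j < i) ==> (s j > s i)]]|.

Definition RLmin n (s : 'S_n) : nat :=
  #|[set i : 'I_n | [forall j : 'I_n, (j > i) ==> (s j > s i)]]|.

Definition da n (s : 'S_n) : nat :=
  #|[set i : 'I_n | (letter s i < letter s i.+1) &&
                    (letter s i.+1 < letter s i.+2)]|.

Definition dd n (s : 'S_n) : nat :=
  #|[set i : 'I_n | (letter s i > letter s i.+1) &&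
                    (letter s i.+1 > letter s i.+2)]|.

Definition peaks n (s : 'S_n) : nat :=
  #|[set i : 'I_n | (letter s i < letter s i.+1) &&
                    (letter s i.+1 > letter s i.+2)]|.

Local Open Scope ring_scope.

(* Since LRmin and RLmin are at least 1 on 'S_n.+1, the truncated subtraction  *)
(* in the exponent is exact.                                                   *)
Definition binomial_stirling_eulerian (R : comNzRingType) (n : nat)
    (x y alpha : R) : R :=
  \sum_(s in PRW n.+1)
    x ^+ des s * y ^+ asc s * alpha ^+ (LRmin s + RLmin s - 2)%N.

(* Main.v *)
(* A word in PRW_(n+1) is D 1 W with D decreasing. Its descents number dd + M  *)
(* and its ascents da + M, so the left-hand side is the right-hand side at     *)
(* (u3, u4) = (y, x), and the right-hand side has to depend only on u1 u2 and  *)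
(* u3 + u4. Let P be the right-hand side and H the weighted sum of the         *)
(* nonempty words placed between two smaller letters, both as functions of     *)
(* the set of letters. Locating the smallest letter a (other than 1) gives     *)
(*    H(a + S) = u1 u2 [S empty] + (u3 + u4) H(S) + (H * H)(S),                *)
(*    P(a + S) = alpha ((u3 + u4) P(S) + (H * P)(S)),                          *)
(* where * sums over the ways to split S in two. In the second equation a      *)
(* belongs to D with weight u4, or W = W' a W'' with W' empty, with weight u3, *)
(* or W = W' a W'' with W' nonempty and weighted by H.                         *)

Require Import Defs.
From HB Require Import structures.
From mathcomp Require Import all_boot all_order all_algebra all_fingroup.
From mathcomp Require Import ring.

Set Implicit Arguments.
Unset Strict Implicit.
Unset Printing Implicit Defensive.

Import GRing.Theory.

Local Open Scope ring_scope.

(** The weight of a word is a product of local factors, one per letter, which see only how the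
    letter compares with its two neighbours. Cutting a word at its smallest letter a thus leaves two
    independent words, for which a is merely a boundary below all their letters. Summing over all
    arrangements turns this cut into a convolution over the ways to split the letters
    ([big_perms_splits]), which gives the recurrence for H, [valley_sum_cons].

    For D 1 W the total P is the convolution of a sum over D and a sum over W ([prw_sum_conv]).
    Adjoining a letter is a derivation for this product, so the factor u4 from D and the factor u3
    from W add up to u3 + u4 ([prw_sum_cons]). Neither recurrence sees u3 and u4 separately, and
    induction on the number of letters shows that P is unchanged when u3 + u4 and the peak weight p
    are kept ([eq_valley_sum], [eq_prw_sum]). The passage from permutations to words rests on
    [big_words], [mem_PRW] and [weight_word]. *)

Section Words.

Variable T : eqType.
Implicit Types (a b : T) (s w : seq T).

(** * Arrangements of letters, cuts and splits *)

Definition cuts w : seq (seq T * seq T) :=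
  [seq (take i w, drop i w) | i <- iota 0 (size w).+1].

Definition insertions a w : seq (seq T) := [seq c.1 ++ a :: c.2 | c <- cuts w].

(** The head is inserted last, so for increasing s the recursion adjoins the smallest letter to
    arrangements of the larger ones. *)
Fixpoint perms s : seq (seq T) :=
  if s is a :: s' then flatten [seq insertions a w | w <- perms s'] else [:: [::]].

Fixpoint splits s : seq (seq T * seq T) :=
  if s is a :: s' then
    [seq (a :: c.1, c.2) | c <- splits s'] ++ [seq (c.1, a :: c.2) | c <- splits s']
  else [:: ([::], [::])].

Lemma cuts_cons a w :
  cuts (a :: w) = ([::], a :: w) :: [seq (a :: c.1, c.2) | c <- cuts w].
Proof.
rewrite /cuts -map_comp -[(size (a :: w)).+1]/(1 + (size w).+1)%N iotaD /=.
by rewrite (iotaDl 1 1) -map_comp.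
Qed.

Lemma mem_perms s w : perm_eq w s -> w \in perms s.
Proof.
elim: s w => [|a s IHs] w; first by move/perm_nilP->.
move=> eq_w; have /splitPr w_a : a \in w by rewrite (perm_mem eq_w) mem_head.
case: w_a eq_w => w1 w2 eq_w.
apply/flatten_mapP; exists (w1 ++ w2).
  by apply: IHs; rewrite -(perm_cons a) -[a :: _ ++ _]cat1s perm_catCA.
apply/mapP; exists (w1, w2) => //; apply/mapP; exists (size w1).
  by rewrite mem_iota size_cat /= add0n ltnS leq_addr.
by rewrite take_size_cat // drop_size_cat.
Qed.

Lemma size_perms s : size (perms s) = (size s)`!.
Proof.
(* The lengths are carried along because a word of length m has m + 1 insertions. *)
suff: all (fun w => size w == size s) (perms s) && (size (perms s) == (size s)`!).
  by case/andP=> _ /eqP.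
elim: s => //= a s /andP[/allP sz_s /eqP IHs].
apply/andP; split.
  apply/allP=> w /flatten_mapP[w' /sz_s/eqP <- /mapP[c /mapP[i _ ->] ->]] /=.
  by rewrite size_cat /= addnS -size_cat cat_take_drop.
rewrite size_flatten /shape -map_comp sumnE big_map.
rewrite (eq_big_seq (fun=> (size s).+1)) => [|w /sz_s/eqP <-].
  by rewrite big_const_seq count_predT iter_addn_0 IHs factS mulnC.
by rewrite /= !size_map size_iota.
Qed.

Lemma perm_eq_perms s w : w \in perms s -> perm_eq w s.
Proof.
elim: s w => [|a s IHs] w; first by rewrite inE => /eqP->.
case/flatten_mapP=> w' /IHs eq_w' /mapP[c /mapP[i _ ->] ->] /=.
by rewrite -cat1s perm_catCA /= perm_cons cat_take_drop.
Qed.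

Lemma splits_subseq s c :
  c \in splits s -> subseq c.1 s && subseq c.2 s.
Proof.
elim: s c => [|a s IHs] c; first by rewrite inE => /eqP->.
rewrite mem_cat => /orP[] /mapP[c' /IHs/andP[sub1 sub2] ->]; apply/andP; split.
- by rewrite /= eqxx.
- exact: subseq_trans sub2 (subseq_cons _ _).
- exact: subseq_trans sub1 (subseq_cons _ _).
- by rewrite /= eqxx.
Qed.

Variable R : comNzRingType.

Lemma big_cuts_cons (G : seq T * seq T -> R) a w :
  \sum_(c <- cuts (a :: w)) G c =
  G ([::], a :: w) + \sum_(c <- cuts w) G (a :: c.1, c.2).
Proof. by rewrite cuts_cons big_cons big_map. Qed.

Lemma big_insertions (F : seq T -> R) a w :
  \sum_(v <- insertions a w) F v = \sum_(c <- cuts w) F (c.1 ++ a :: c.2).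
Proof. by rewrite big_map. Qed.

Lemma big_perms_cons (F : seq T -> R) a s :
  \sum_(w <- perms (a :: s)) F w =
  \sum_(w <- perms s) \sum_(c <- cuts w) F (c.1 ++ a :: c.2).
Proof.
by rewrite big_flatten big_map; apply: eq_bigr => w _; rewrite big_insertions.
Qed.

Lemma cuts_nil : cuts [::] = [:: ([::], [::])].
Proof. by []. Qed.

(** When a word containing the new letter b is cut, b falls into one of the two pieces; removing it
    leaves a cut of w. In the induction on w, the cut before the first letter is set apart. *)
Lemma big_insertions_cuts (G : seq T -> seq T -> R) b w :
  \sum_(v <- insertions b w) \sum_(c <- cuts v) G c.1 c.2 =
  \sum_(c <- cuts w) (\sum_(v <- insertions b c.1) G v c.2
                      + \sum_(v <- insertions b c.2) G c.1 v).
Proof.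
elim: w G => [|a w IHw] G.
  rewrite big_insertions cuts_nil [LHS]big_seq1 [RHS]big_seq1 !big_insertions /=.
  by rewrite cuts_nil !big_seq1 big_cuts_cons cuts_nil big_seq1 addrC.
rewrite big_insertions big_cuts_cons /= !big_cuts_cons.
have -> : \sum_(c <- cuts w) \sum_(d <- cuts (a :: c.1 ++ b :: c.2)) G d.1 d.2 =
    \sum_(c <- cuts w) G [::] (a :: c.1 ++ b :: c.2) +
    \sum_(v <- insertions b w) \sum_(d <- cuts v) G (a :: d.1) d.2.
  rewrite big_insertions -big_split; apply: eq_bigr => c _.
  by rewrite big_cuts_cons.
rewrite (IHw (fun v => G (a :: v))).
rewrite !big_insertions cuts_nil big_seq1 big_cuts_cons /=.
have -> : \sum_(c <- cuts w) (\sum_(v <- insertions b (a :: c.1)) G v c.2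
                      + \sum_(v <- insertions b c.2) G (a :: c.1) v) =
    \sum_(c <- cuts w) G [:: b, a & c.1] c.2 +
    \sum_(c <- cuts w) (\sum_(v <- insertions b c.1) G (a :: v) c.2
                      + \sum_(v <- insertions b c.2) G (a :: c.1) v).
  rewrite -big_split; apply: eq_bigr => c _ /=.
  by rewrite !big_insertions big_cuts_cons addrA.
ring.
Qed.

(** By [big_insertions_cuts] each new letter joins the left or the right piece, which is the
    recursion defining [splits]. *)
Lemma big_perms_cuts (G : seq T -> seq T -> R) s :
  \sum_(w <- perms s) \sum_(c <- cuts w) G c.1 c.2 =
  \sum_(c <- splits s) \sum_(w1 <- perms c.1) \sum_(w2 <- perms c.2) G w1 w2.
Proof.
elim: s G => [|b s IHs] G; first by rewrite !big_seq1.
rewrite big_flatten big_map.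
under eq_bigr do rewrite big_insertions_cuts.
rewrite (IHs (fun w1 w2 => \sum_(v <- insertions b w1) G v w2
                         + \sum_(v <- insertions b w2) G w1 v)).
rewrite big_cat !big_map /= -big_split; apply: eq_bigr => c _ /=.
rewrite big_flatten big_map /= -big_split; apply: eq_bigr => w1 _ /=.
rewrite big_flatten big_map exchange_big /= -big_split.
by apply: eq_bigr => w2 _.
Qed.

Lemma big_perms_splits (F : seq T -> R) a s :
  \sum_(w <- perms (a :: s)) F w =
  \sum_(c <- splits s) \sum_(w1 <- perms c.1) \sum_(w2 <- perms c.2)
    F (w1 ++ a :: w2).
Proof.
by rewrite big_perms_cons (big_perms_cuts (fun w1 w2 => F (w1 ++ a :: w2))).
Qed.

(** * Convolution of functions of a set of letters *)

Definition conv (f g : seq T -> R) s : R := \sum_(c <- splits s) f c.1 * g c.2.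

Definition is_nil s : R := (nilp s)%:R.

Implicit Types f g h : seq T -> R.

(* Adjoining a letter acts as a derivation for the convolution product. *)
Lemma conv_cons f g a s :
  conv f g (a :: s) = conv (f \o cons a) g s + conv f (g \o cons a) s.
Proof. by rewrite /conv big_cat !big_map. Qed.

Lemma conv_nil f g : conv f g [::] = f [::] * g [::].
Proof. by rewrite /conv big_seq1. Qed.

Lemma eq_conv_in f1 f2 g1 g2 s :
    (forall t, subseq t s -> f1 t = f2 t) ->
    (forall t, subseq t s -> g1 t = g2 t) ->
  conv f1 g1 s = conv f2 g2 s.
Proof.
move=> eq_f eq_g; apply: eq_big_seq => c /splits_subseq/andP[sub1 sub2].
by rewrite eq_f ?eq_g.
Qed.

(** Both sides agree on the empty word and obey the same Leibniz rule, so induction on the letters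
    suffices; [convA] is proved in the same way. *)
Lemma convC f g s : conv f g s = conv g f s.
Proof.
elim: s f g => [|a s IHs] f g; first by rewrite !conv_nil mulrC.
by rewrite !conv_cons addrC; congr (_ + _); apply: IHs.
Qed.

Lemma convDl f g h s : conv (fun t => f t + g t) h s = conv f h s + conv g h s.
Proof. by rewrite -big_split; apply: eq_bigr => c _; rewrite mulrDl. Qed.

Lemma convDr f g h s : conv f (fun t => g t + h t) s = conv f g s + conv f h s.
Proof. by rewrite -big_split; apply: eq_bigr => c _; rewrite mulrDr. Qed.

Lemma convZl k f g s : conv (fun t => k * f t) g s = k * conv f g s.
Proof. by rewrite /conv big_distrr; apply: eq_bigr => c _; rewrite /= mulrA. Qed.

Lemma convZr k f g s : conv f (fun t => k * g t) s = k * conv f g s.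
Proof. by rewrite convC convZl convC. Qed.

Lemma conv_is_nil f s : conv is_nil f s = f s.
Proof.
elim: s f => [|a s IHs] f; first by rewrite conv_nil mul1r.
rewrite conv_cons IHs /= [X in X + _]big1 ?add0r // => c _.
by rewrite /is_nil /= mul0r.
Qed.

Lemma convA f g h s : conv f (conv g h) s = conv (conv f g) h s.
Proof.
elim: s f g h => [|a s IHs] f g h; first by rewrite !conv_nil mulrA.
rewrite !conv_cons.
rewrite (@eq_conv_in f f (conv g h \o cons a) (fun t =>
  conv (g \o cons a) h t + conv g (h \o cons a) t))
  => [|//|t _]; last exact: conv_cons.
rewrite (@eq_conv_in (conv f g \o cons a) (fun t =>
  conv (f \o cons a) g t + conv f (g \o cons a) t) h h)
  => [|t _|//]; last exact: conv_cons.
by rewrite convDl convDr !IHs addrA.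
Qed.

End Words.

(** * Minima, decreasing prefixes and admissible letter sets *)

Fixpoint rlmin (w : seq nat) : nat :=
  if w is c :: w' then (all (ltn c) w' + rlmin w')%N else 0%N.

Lemma rlmin_cat a w1 w2 :
  all (ltn a) w1 -> rlmin (w1 ++ a :: w2) = rlmin (a :: w2).
Proof.
elim: w1 => //= c w1 IHw /andP[lt_ac /IHw ->].
by rewrite all_cat /= [(c < a)%N]ltnNge ltnW // andbF.
Qed.

Lemma rlmin_sorted w : sorted ltn w -> rlmin w = size w.
Proof.
elim: w => //= c w IHw c_w; rewrite (order_path_min ltn_trans c_w).
by rewrite IHw // (path_sorted c_w).
Qed.

Definition prw (w : seq nat) : bool := sorted gtn (take (index 1%N w) w).

(** Sortedness makes the head the smallest letter; 1 and N serve as boundary letters below and above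
    all others. *)
Definition good N (s : seq nat) : bool := path ltn 1%N s && all (ltn^~ N) s.

Lemma good_subseq N s t : subseq t s -> good N s -> good N t.
Proof.
move=> t_s /andP[s1 sN]; rewrite /good (subseq_path ltn_trans t_s s1).
by apply/allP=> c /(mem_subseq t_s)/(allP sN).
Qed.

Lemma good_cons N a s : good N (a :: s) ->
  [/\ (1 < a)%N, (a < N)%N, all (ltn a) s & good N s].
Proof.
move=> Nas; have /andP[/= /andP[lt1a a_s] /andP[ltaN _]] := Nas; split=> //.
  exact: order_path_min ltn_trans a_s.
exact: good_subseq (subseq_cons s a) Nas.
Qed.

Lemma good_min N s : good N s -> all (ltn 1%N) s.
Proof. by case/andP=> /(order_path_min ltn_trans). Qed.

Lemma good_max N s : good N s -> all (ltn^~ N) s.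
Proof. by case/andP. Qed.

Lemma all_perms (T : eqType) (P : pred T) s w : w \in perms s -> all P w = all P s.
Proof. by move/perm_eq_perms/perm_all. Qed.

Lemma nilp_perms (T : eqType) (s w : seq T) : w \in perms s -> nilp w = nilp s.
Proof. by move/perm_eq_perms/perm_size; rewrite /nilp => ->. Qed.

Lemma all_ltn_trans a b w : (a < b)%N -> all (ltn b) w -> all (ltn a) w.
Proof. by move=> ltab; apply: sub_all => c /=; apply: ltn_trans. Qed.

(** If w precedes the smallest letter a, the left neighbour of a is a letter of w, hence larger,
    unless w is empty and the neighbour is the low boundary l. *)
Lemma last_lt_min l a w : (l < a)%N -> all (ltn a) w -> (last l w < a)%N = nilp w.
Proof.
case/lastP: w => // w c _; rewrite last_rcons all_rcons => /andP[ltac _].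
by rewrite ltnNge ltnW //= /nilp size_rcons.
Qed.

Lemma min_lt_head r a w : (r < a)%N -> all (ltn a) w -> (a < head r w)%N = ~~ nilp w.
Proof. by case: w => [|c w] /= ltra => [_|/andP[]//]; rewrite ltnNge ltnW. Qed.

(** * Weighted sums over words and their recurrences *)

Section Weights.

Variable R : comNzRingType.
Variables p u3 u4 alpha : R.

(** The branches are, in order: double ascent, peak, valley, double descent. The parameter p stands
    for u1 u2. *)
Definition local_weight (l c r : nat) : R :=
  if (l < c)%N then if (c < r)%N then u3 else p
  else if (c < r)%N then 1 else u4.

Fixpoint weight (l : nat) (w : seq nat) (r : nat) : R :=
  if w is c :: w' then local_weight l c (head r w') * weight c w' r else 1.

Lemma weight_cat l w1 a w2 r :
  weight l (w1 ++ a :: w2) r =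
  weight l w1 a * local_weight (last l w1) a (head r w2) * weight a w2 r.
Proof.
elim: w1 l => [|c w1 IHw] l /=; first by rewrite mul1r.
by rewrite IHw !mulrA; case: w1 {IHw}.
Qed.

Lemma weight_low_left l l' w r :
  all (ltn l) w -> all (ltn l') w -> weight l w r = weight l' w r.
Proof.
by case: w => //= c w /andP[ltlc _] /andP[ltl'c _]; rewrite /local_weight ltlc ltl'c.
Qed.

Lemma weight_low_right l w r r' :
  all (ltn r) w -> all (ltn r') w -> weight l w r = weight l w r'.
Proof.
elim: w l => //= c w IHw l /andP[ltrc rw] /andP[ltr'c r'w]; rewrite (IHw c) //.
case: w {IHw} rw r'w => //= _ _.
by rewrite /local_weight !(ltnNge c) (ltnW ltrc) (ltnW ltr'c).
Qed.

(* The boundary value 1 lies below every letter, and [valley_sum] is 0 on the   *)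
(* empty word, whose weight depends on the neighbouring letter. For a word      *)
(* D 1 W, [head_sum] ranges over D and [tail_sum] over W, with N as +oo.        *)
Definition valley_sum s : R :=
  if nilp s then 0 else \sum_(w <- perms s) weight 1 w 1.

Definition tail_sum N s : R :=
  \sum_(w <- perms s) weight 1 w N * alpha ^+ rlmin w.

Definition head_sum N s : R :=
  \sum_(w <- perms s) (sorted gtn w)%:R * (weight N w 1 * alpha ^+ size w).

(** This is P as a function of the letters other than 1. The boundary N on both sides is the
    convention +oo, and left-to-right minima are counted on the reversed word. *)
Definition prw_sum N s : R :=
  \sum_(w <- perms (1%N :: s))
    (prw w)%:R * (weight N w N * alpha ^+ (rlmin (rev w) + rlmin w - 2)).


(** In w1 a w2 with a smallest, a is a peak if both parts are empty, a double ascent if only w1 is,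
    a double descent if only w2 is, and a valley otherwise. *)
Lemma valley_sum_cons N a s : good N (a :: s) ->
  valley_sum (a :: s) =
  p * is_nil R s + (u3 + u4) * valley_sum s + conv valley_sum valley_sum s.
Proof.
case/good_cons=> lt1a _ a_s s_good.
(* [is_nil] is the unit of the convolution; with it every term becomes a sum over splits, and the
   identity can be checked split by split. *)
rewrite -[is_nil R s]conv_is_nil mulrDl -{2}[valley_sum s]conv_is_nil.
rewrite (convC _ valley_sum) -[valley_sum s]conv_is_nil -!convZl.
rewrite {1}/valley_sum big_perms_splits -!big_split; apply: eq_big_seq => -[s1 s2].
case/splits_subseq/andP=> /= sub1 sub2; have a1 : all (ltn a) s1.
  by apply/allP=> c /(mem_subseq sub1)/(allP a_s).
have a2 : all (ltn a) s2 by apply/allP=> c /(mem_subseq sub2)/(allP a_s).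
transitivity ((if nilp s1 then if nilp s2 then p else u3
                          else if nilp s2 then u4 else 1) *
    ((\sum_(w1 <- perms s1) weight 1 w1 1) * \sum_(w2 <- perms s2) weight 1 w2 1)).
  rewrite big_distrlr big_distrr; apply: eq_big_seq => w1 /= w1_s1.
  rewrite big_distrr; apply: eq_big_seq => w2 /= w2_s2.
  rewrite -(all_perms _ w1_s1) in a1; rewrite -(all_perms _ w2_s2) in a2.
  (* Both parts have the boundary a on one side; it may be replaced by 1, since either lies below
     all their letters. *)
  rewrite weight_cat (weight_low_right _ a1 (all_ltn_trans lt1a a1)).
  rewrite (weight_low_left _ a2 (all_ltn_trans lt1a a2)) /local_weight.
  rewrite last_lt_min // min_lt_head // (nilp_perms w1_s1) (nilp_perms w2_s2).
  by case: (nilp s1); case: (nilp s2) => /=; ring.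
rewrite /valley_sum /is_nil /=;
  case: (altP nilP) => [->|_]; case: (altP nilP) => [->|_]; rewrite ?big_seq1 /=; ring.
Qed.

(** No letter before a is a right-to-left minimum, while a is one and contributes alpha. The right
    neighbour of a is larger in every case, N included, so a is a double ascent or a valley
    according to whether w1 is empty. *)
Lemma tail_sum_cons N a s : good N (a :: s) ->
  tail_sum N (a :: s) =
  alpha * (u3 * tail_sum N s + conv valley_sum (tail_sum N) s).
Proof.
case/good_cons=> lt1a ltaN a_s s_good.
rewrite -[tail_sum N s]conv_is_nil mulrDr mulrA -!convZl -convDl.
rewrite {1}/tail_sum big_perms_splits; apply: eq_big_seq => -[s1 s2].
case/splits_subseq/andP=> /= sub1 sub2; have a1 : all (ltn a) s1.
  by apply/allP=> c /(mem_subseq sub1)/(allP a_s).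
have a2 : all (ltn a) s2 by apply/allP=> c /(mem_subseq sub2)/(allP a_s).
transitivity (alpha * (if nilp s1 then u3 else 1) *
    ((\sum_(w1 <- perms s1) weight 1 w1 1) * tail_sum N s2)).
  rewrite big_distrlr big_distrr; apply: eq_big_seq => w1 /= w1_s1.
  rewrite big_distrr; apply: eq_big_seq => w2 /= w2_s2.
  rewrite -(all_perms _ w1_s1) in a1; rewrite -(all_perms _ w2_s2) in a2.
  rewrite weight_cat (weight_low_right _ a1 (all_ltn_trans lt1a a1)).
  rewrite (weight_low_left _ a2 (all_ltn_trans lt1a a2)) /local_weight.
  have -> : (a < head N w2)%N by case: w2 a2 {w2_s2} => //= c w2 /andP[].
  rewrite rlmin_cat //= a2 last_lt_min // (nilp_perms w1_s1) exprS.
  by case: (nilp s1) => /=; ring.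
rewrite /valley_sum /is_nil /=; case: (altP nilP) => [->|_]; rewrite ?big_seq1 /=; ring.
Qed.

(** In a decreasing word the smallest letter a comes last. It is then a double descent, between a
    larger letter (or N) and the 1 that follows D. *)
Lemma head_sum_cons N a s : good N (a :: s) ->
  head_sum N (a :: s) = alpha * u4 * head_sum N s.
Proof.
case/good_cons=> lt1a ltaN a_s s_good.
rewrite -[head_sum N s]conv_is_nil convC -convZl.
rewrite {1}/head_sum big_perms_splits; apply: eq_big_seq => -[s1 s2].
case/splits_subseq/andP=> /= sub1 sub2; have a1 : all (ltn a) s1.
  by apply/allP=> c /(mem_subseq sub1)/(allP a_s).
have a2 : all (ltn a) s2 by apply/allP=> c /(mem_subseq sub2)/(allP a_s).
have N1 : all (ltn^~ N) s1.
  by apply/allP=> c /(mem_subseq sub1)/(allP (good_max s_good)).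
rewrite mulrAC big_distrr; apply: eq_big_seq => w1 /= w1_s1.
rewrite -(all_perms _ w1_s1) in a1; rewrite -(all_perms _ w1_s1) in N1.
rewrite /is_nil; case: (altP nilP) a2 => [->|]; last first.
  (* If s2 is nonempty, a is followed by a larger letter and the word is not decreasing. *)
  case: s2 {sub2} => // b s2 _ a2; rewrite big1_seq ?mulr0 ?mul0r // => w2 /andP[_ w2_s2].
  rewrite -(all_perms _ w2_s2) in a2; move: (nilp_perms w2_s2).
  case: w2 {w2_s2} a2 => //= c w2 /andP[lt_ac _] _.
  case: (boolP (sorted _ _)) => [/cat_sorted2[_ /= /andP[]]|_]; last by rewrite mul0r.
  by rewrite ltnNge ltnW.
move=> _; rewrite big_seq1 mulr1 weight_cat.
rewrite (weight_low_right _ a1 (all_ltn_trans lt1a a1)).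
rewrite cats1 size_rcons exprS /= /local_weight [(a < 1)%N]ltnNge (ltnW lt1a) /=.
have -> : (last N w1 < a)%N = false.
  case/lastP: w1 a1 {w1_s1 N1} => [|w c]; first by rewrite ltnNge ltnW.
  by rewrite last_rcons all_rcons => /andP[ltac _]; rewrite ltnNge ltnW.
suff -> : sorted gtn (rcons w1 a) = sorted gtn w1 by ring.
case: w1 a1 {w1_s1 N1} => //= b w1 /andP[ltab a1]; rewrite rcons_path.
case/lastP: w1 a1 => [|w c]; first by rewrite /= ltab.
by rewrite last_rcons all_rcons => /andP[/= -> _]; rewrite andbT.
Qed.

(** The letter 1 is a valley and has weight 1. Besides 1, the left-to-right minima are all the
    letters of D, and the right-to-left minima are those of W; the exponent - 2 discounts 1 from
    both counts. *)
Lemma prw_sum_conv N s : (1 < N)%N -> good N s ->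
  prw_sum N s = conv (head_sum N) (tail_sum N) s.
Proof.
move=> lt1N s_good; rewrite /prw_sum big_perms_splits.
apply: eq_big_seq => -[s1 s2] /splits_subseq/andP[/= sub1 sub2].
have a1 := good_min (good_subseq sub1 s_good).
have a2 := good_min (good_subseq sub2 s_good).
rewrite big_distrlr; apply: eq_big_seq => w1 /= w1_s1.
apply: eq_big_seq => w2 /= w2_s2.
rewrite -(all_perms _ w1_s1) in a1; rewrite -(all_perms _ w2_s2) in a2.
have -> : prw (w1 ++ 1%N :: w2) = sorted gtn w1.
  have /negPf w1_1 : 1%N \notin w1 by apply/negP=> /(allP a1).
  by rewrite /prw index_cat w1_1 /= addn0 take_size_cat.
case: (boolP (sorted gtn w1)) => [dec_w1|_]; last by rewrite !mul0r.
rewrite rev_cat rev_cons cat_rcons !rlmin_cat ?all_rev //= a2 all_rev a1.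
rewrite rlmin_sorted ?rev_sorted // size_rev addnACA addKn exprD.
rewrite weight_cat /local_weight.
have -> : (1 < head N w2)%N by case: w2 a2 {w2_s2} => //= c w2 /andP[].
have -> : (last N w1 < 1)%N = false.
  case/lastP: w1 a1 {w1_s1 dec_w1} => [|w c]; first by rewrite ltnNge ltnW.
  by rewrite last_rcons all_rcons => /andP[lt1c _]; rewrite ltnNge ltnW.
by ring.
Qed.

Lemma prw_sum_cons N a s : (1 < N)%N -> good N (a :: s) ->
  prw_sum N (a :: s) =
  alpha * ((u3 + u4) * prw_sum N s + conv valley_sum (prw_sum N) s).
Proof.
move=> lt1N as_good; have [_ _ _ s_good] := good_cons as_good.
(* By the Leibniz rule the new letter a goes either to D or to W. *)
rewrite (prw_sum_conv lt1N as_good) (prw_sum_conv lt1N s_good) conv_cons.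
rewrite (@eq_conv_in _ _ valley_sum valley_sum (prw_sum N)
  (conv (head_sum N) (tail_sum N))) => [|//|t t_s]; last first.
  exact/prw_sum_conv/(good_subseq t_s).
have sub_good t : subseq t s -> good N (a :: t).
  by move=> t_s; apply: good_subseq as_good; rewrite /= eqxx.
rewrite (@eq_conv_in _ _ _ (fun t => alpha * u4 * head_sum N t)
   (tail_sum N) (tail_sum N)) => [|t /sub_good/head_sum_cons //|//].
rewrite (@eq_conv_in _ _ (head_sum N) (head_sum N) _
  (fun t => alpha * (u3 * tail_sum N t + conv valley_sum (tail_sum N) t)))
  => [|//|t /sub_good/tail_sum_cons //].
(* The factor [valley_sum] produced inside W is moved to the front, past [head_sum], so that
   [head_sum] and [tail_sum] recombine into [prw_sum]. *)
rewrite convZl convZr convDr convZr convA.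
rewrite (@eq_conv_in _ _ (conv (head_sum N) valley_sum)
  (conv valley_sum (head_sum N)) (tail_sum N) (tail_sum N)) //.
  by rewrite -convA; ring.
by move=> t _; apply: convC.
Qed.

Lemma prw_sum_nil N : (1 < N)%N -> prw_sum N [::] = 1.
Proof.
move=> lt1N; rewrite prw_sum_conv // conv_nil /head_sum /tail_sum !big_seq1 /=.
by rewrite !mulr1.
Qed.

End Weights.

(** * Dependence on u3 and u4 only through their sum *)

Section Invariance.

Variable R : comNzRingType.
Variables p u3 u4 v3 v4 alpha : R.
Hypothesis eq_sum : u3 + u4 = v3 + v4.

Lemma eq_valley_sum N s : good N s -> valley_sum p u3 u4 s = valley_sum p v3 v4 s.
Proof.
have [n] := ubnP (size s); elim: n s => // n IHn [|a s] // lt_s_n as_good.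
have [_ _ _ s_good] := good_cons as_good.
have eq_sub t : subseq t s -> valley_sum p u3 u4 t = valley_sum p v3 v4 t.
  move=> t_s; apply: IHn (good_subseq t_s s_good).
  exact: leq_ltn_trans (size_subseq t_s) lt_s_n.
rewrite !(valley_sum_cons _ _ _ as_good) eq_sum eq_sub //.
by congr (_ + _); apply: eq_conv_in.
Qed.

Lemma eq_prw_sum N s : (1 < N)%N -> good N s ->
  prw_sum p u3 u4 alpha N s = prw_sum p v3 v4 alpha N s.
Proof.
move=> lt1N; have [n] := ubnP (size s); elim: n s => // n IHn [|a s] // lt_s_n.
  by rewrite !prw_sum_nil.
move=> as_good; have [_ _ _ s_good] := good_cons as_good.
have eq_sub t : subseq t s -> prw_sum p u3 u4 alpha N t = prw_sum p v3 v4 alpha N t.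
  move=> t_s; apply: IHn (good_subseq t_s s_good).
  exact: leq_ltn_trans (size_subseq t_s) lt_s_n.
rewrite !(prw_sum_cons _ _ _ _ lt1N as_good) eq_sum eq_sub //.
congr (_ * (_ + _)); apply: eq_conv_in => // t t_s.
exact/eq_valley_sum/(good_subseq t_s s_good).
Qed.

End Invariance.

(** * From permutations to words *)

Arguments letter : simpl never.

Definition word n (s : 'S_n) : seq nat := [seq (s i).+1 | i <- enum 'I_n].

Lemma size_word n (s : 'S_n) : size (word s) = n.
Proof. by rewrite size_map size_enum_ord. Qed.

Lemma nth_word n (s : 'S_n) x0 (i : 'I_n) : nth x0 (word s) i = (s i).+1.
Proof. by rewrite (nth_map i) ?size_enum_ord // nth_ord_enum. Qed.

Lemma letterS n (s : 'S_n) (i : 'I_n) : letter s i.+1 = (s i).+1.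
Proof. by rewrite /letter valK. Qed.

Lemma letter_out n (s : 'S_n) i : (n <= i)%N -> letter s i.+1 = n.+1.
Proof. by move=> le_ni; rewrite /letter insubF // ltnNge le_ni. Qed.

(** The prepended letter and the default value of [nth], both n + 1, realise the two infinite
    boundary letters. *)
Lemma letter_nth n (s : 'S_n) i : letter s i = nth n.+1 (n.+1 :: word s) i.
Proof.
case: i => // i; have [lt_in|le_ni] := ltnP i n; last first.
  by rewrite letter_out // nth_default //= size_word.
by rewrite (letterS s (Ordinal lt_in)) /= -(nth_word s n.+1).
Qed.

Lemma letter_gt0 n (s : 'S_n) i : (0 < letter s i)%N.
Proof. by rewrite /letter; case: i => // i; case: insub. Qed.

Lemma letterS_leq n (s : 'S_n) i : (i < n)%N -> (letter s i.+1 <= n)%N.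
Proof. by move=> lt_in; rewrite (letterS s (Ordinal lt_in)). Qed.

Lemma letterS_inj n (s : 'S_n) i j : (i < n)%N -> (j < n)%N ->
  letter s i.+1 = letter s j.+1 -> i = j.
Proof.
move=> lt_in lt_jn.
rewrite (letterS s (Ordinal lt_in)) (letterS s (Ordinal lt_jn)).
by case=> /val_inj/perm_inj[].
Qed.

Lemma letter_neq n (s : 'S_n) i : (i <= n)%N -> (0 < n)%N ->
  letter s i != letter s i.+1.
Proof.
case: i => [_ n_gt0|i lt_in _].
  by rewrite gtn_eqF // ltnS letterS_leq.
have [lt_Sin|le_nSi] := ltnP i.+1 n.
  by apply/eqP=> /(letterS_inj lt_in lt_Sin)/eqP; rewrite ltn_eqF.
by rewrite (letter_out s le_nSi) ltn_eqF // ltnS letterS_leq.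
Qed.

Lemma word_inj n : injective (@word n).
Proof.
move=> s t eq_st; apply/permP=> i; apply/val_inj/succn_inj.
by rewrite /= -!(nth_word _ 0) eq_st.
Qed.

Lemma perm_word n (s : 'S_n) : perm_eq (word s) (iota 1 n).
Proof.
have -> : iota 1 n = [seq i.+1 | i <- map val (enum 'I_n)].
  by rewrite val_enum_ord (iotaDl 1 0).
rewrite /word -map_comp (map_comp (fun i : 'I_n => i.+1) s).
apply: perm_map; apply: uniq_perm.
- by rewrite map_inj_uniq ?enum_uniq //; apply: perm_inj.
- exact: enum_uniq.
move=> i; rewrite mem_enum; apply/mapP; exists ((s^-1)%g i); rewrite ?mem_enum //.
by rewrite permKV.
Qed.

(** [word] is injective with values in the list of arrangements; both sides have n! entries, so the
    two lists agree up to order. *)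
Lemma big_words (R : comNzRingType) n (F : seq nat -> R) :
  \sum_(s : 'S_n) F (word s) = \sum_(w <- perms (iota 1 n)) F w.
Proof.
rewrite -big_enum -(big_map (@word n) xpredT F); apply: perm_big.
have uniq_words : uniq (map (@word n) (enum 'S_n)).
  by rewrite map_inj_uniq ?enum_uniq //; apply: word_inj.
have sub_words : {subset map (@word n) (enum 'S_n) <= perms (iota 1 n)}.
  by move=> w /mapP[s _ ->]; apply/mem_perms/perm_word.
have size_words : (size (perms (iota 1 n)) <= size (map (@word n) (enum 'S_n)))%N.
  by rewrite size_perms size_iota size_map -cardE card_Sn.
have [_ eq_words] := uniq_min_size uniq_words sub_words size_words.
by apply: uniq_perm (leq_size_uniq uniq_words sub_words size_words) eq_words.
Qed.

Lemma card_set_sum n (P : pred 'I_n) : #|[set i | P i]| = (\sum_(i < n) P i)%N.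
Proof. by rewrite cardsE -sum1_card big_mkcond. Qed.

Lemma rlmin_sum w :
  rlmin w = (\sum_(i < size w) [forall j : 'I_(size w),
                                 (i < j) ==> (nth 0 w i < nth 0 w j)])%N.
Proof.
have -> : rlmin w = (\sum_(i < size w) all (ltn (nth 0 w i)) (drop i.+1 w))%N.
  by elim: w => [|c w IHw] /=; rewrite ?big_ord0 // big_ord_recl /= drop0 IHw.
apply: eq_bigr => i _; congr nat_of_bool.
apply/(all_nthP 0)/forallP=> /= [lt_i j | lt_i j].
  apply/implyP=> lt_ij; have := lt_i (j - i.+1)%N.
  rewrite size_drop nth_drop subnKC // ltn_sub2r //.
    by apply.
  exact: leq_ltn_trans (ltn_ord j).
rewrite size_drop nth_drop ltn_subRL => lt_ij.
by have /implyP := lt_i (Ordinal lt_ij); apply; rewrite /= addSn ltnS leq_addr.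
Qed.

Lemma RLmin_word n (s : 'S_n) : RLmin s = rlmin (word s).
Proof.
rewrite rlmin_sum size_word /RLmin card_set_sum; apply: eq_bigr => i _.
by congr nat_of_bool; apply: eq_forallb => j; rewrite !nth_word ltnS.
Qed.

Lemma LRmin_word n (s : 'S_n) : LRmin s = rlmin (rev (word s)).
Proof.
rewrite rlmin_sum size_rev size_word /LRmin card_set_sum.
rewrite (reindex_inj rev_ord_inj); apply: eq_bigr => i _; congr nat_of_bool.
have nth_rev_word (k : 'I_n) : nth 0 (rev (word s)) k = (s (rev_ord k)).+1.
  by rewrite nth_rev size_word // -(nth_word s 0).
have lt_rev (a b : 'I_n) : (rev_ord a < rev_ord b)%N = (b < a)%N.
  by rewrite /= ltn_sub2lE.
apply/forallP/forallP=> lt_s j; have := lt_s (rev_ord j); rewrite !nth_rev_word ltnS.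
  by rewrite lt_rev.
by rewrite rev_ordK -lt_rev rev_ordK.
Qed.

Lemma weight_prod (R : comNzRingType) (p u3 u4 : R) l w r :
  weight p u3 u4 l w r =
  \prod_(i < size w)
    local_weight p u3 u4 (nth r (l :: w) i) (nth r w i) (nth r w i.+1).
Proof.
elim: w l => [|c w IHw] l /=; first by rewrite big_ord0.
by rewrite big_ord_recl IHw /= -nth0.
Qed.

(** Adjacent letters differ, boundaries included, so each position is of exactly one of the four
    types, and valleys weigh 1. *)
Lemma weight_word (R : comNzRingType) (p u3 u4 : R) n (s : 'S_n) :
  weight p u3 u4 n.+1 (word s) n.+1 = p ^+ peaks s * u3 ^+ da s * u4 ^+ dd s.
Proof.
rewrite weight_prod size_word /peaks /da /dd !card_set_sum -!prodrXr -!big_split.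
apply: eq_bigr => i _ /=; have n_gt0 : (0 < n)%N by apply: leq_trans (ltn_ord i).
have neq_l := letter_neq s (ltnW (ltn_ord i)) n_gt0.
have neq_r := letter_neq s (ltn_ord i) n_gt0.
have nthE j : nth n.+1 (word s) j = letter s j.+1 by rewrite letter_nth.
rewrite -letter_nth !nthE /local_weight.
case: (ltngtP (letter s i) (letter s i.+1)) neq_l => // _ _;
  case: (ltngtP (letter s i.+1) (letter s i.+2)) neq_r => // _ _;
  by rewrite ?(expr1, expr0, mulr1, mul1r).
Qed.

Lemma des_word n (s : 'S_n) : des s = (dd s + peaks s)%N.
Proof.
rewrite /des /dd /peaks !card_set_sum -big_split /=.
case: n s => [|n] s; first by rewrite !big_ord0.
(* The indices are shifted by one: index 0 is never a descent, and the last letter is followed by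
   +oo. *)
rewrite big_ord_recl [RHS]big_ord_recr /= /is_descent /=.
rewrite (letter_out s (leqnn _)) [(n.+2 < _)%N]ltnNge (leqW (letterS_leq _ _)) //.
rewrite !andbF !addn0 add0n; apply: eq_bigr => i _.
rewrite /bump /= add1n ltnS ltn_ord /=.
have := letter_neq s (leqW (ltnW (ltn_ord i))) isT.
by case: (ltngtP (letter s i) (letter s i.+1)) => // _ _; rewrite addn0.
Qed.

Lemma asc_word n (s : 'S_n) : asc s = (da s + peaks s)%N.
Proof.
rewrite /asc /da /peaks !card_set_sum -big_split /=; apply: eq_bigr => i _.
have n_gt0 : (0 < n)%N by apply: leq_trans (ltn_ord i).
have := letter_neq s (ltn_ord i) n_gt0; rewrite /is_ascent ltn_ord andbT.
(* No shift here: at i = 0 the left neighbour is +oo, so the first letter is neither a double ascent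
   nor a peak. *)
have [i0|i_gt0] := posnP i.
  by rewrite i0 /= ltnNge (leqW (letterS_leq _ _)).
by case: (ltngtP (letter s i.+1)) => // _ _; rewrite !(andbT, andbF, addn0).
Qed.

(** An ascent before the letter 1 would force a first ascent there, at another letter. Conversely,
    if the letters before 1 decrease, the first possible ascent starts at 1. *)
Lemma mem_PRW n (s : 'S_n.+1) : (s \in PRW n.+1) = prw (word s).
Proof.
have word1 : 1%N \in word s by rewrite (perm_mem (perm_word s)) mem_head.
(* Indices in [word] start at 0, so 1 is the letter at position k + 1. *)
pose k := index 1%N (word s).
have lt_kn : (k < n.+1)%N by rewrite -(size_word s) index_mem.
have letter_k : letter s k.+1 = 1%N by rewrite letter_nth /= nth_index.
have sorted_k : reflect (forall i, i.+1 < k -> letter s i.+1 > letter s i.+2)%N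
                        (prw (word s)).
  have size_k : size (take k (word s)) = k by rewrite size_takel // size_word ltnW.
  apply: (iffP (sortedP n.+2)); rewrite size_k => desc i lt_ik; have := desc i lt_ik.
    by rewrite !nth_take ?(ltnW lt_ik) // !letter_nth.
  by rewrite !letter_nth /= !nth_take ?(ltnW lt_ik).
rewrite inE; apply/forallP/sorted_k => [first1 i lt_ik | desc i].
  have lt_in : (i.+1 < n.+1)%N := ltn_trans lt_ik lt_kn.
  have := letter_neq s (ltnW lt_in) isT; case: ltngtP => // asc_i _.
  have asc_Si : is_ascent s (Ordinal lt_in) by rewrite /is_ascent /= lt_in.
  (* The least ascent j is a first ascent, so its letter is 1; but j < k while 1 stands at position
     k + 1. *)
  case: (arg_minnP (P := fun j : 'I_n.+1 => is_ascent s j) val asc_Si) => j asc_j min_j.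
  have lt_jk : (j < k)%N := leq_ltn_trans (min_j _ asc_Si) lt_ik.
  have /implyP := first1 j; rewrite /is_first_ascent asc_j.
  have -> : [forall j' : 'I_n.+1, is_ascent s j' ==> (j <= j')%N].
    by apply/forallP=> j'; apply/implyP/min_j.
  case/andP: asc_j => /andP[j_gt0 lt_jn] _ /(_ isT)/eqP letter_j.
  have eq_jk : j.-1 = k.
    apply: (@letterS_inj _ s _ _ (leq_ltn_trans (leq_pred j) lt_jn) lt_kn).
    by rewrite prednK // letter_j letter_k.
  by move: lt_jk; rewrite -eq_jk ltnNge leq_pred.
apply/implyP=> /andP[/andP[/andP[i_gt0 lt_in] asc_i] /forallP min_i].
suff -> : nat_of_ord i = k.+1 by rewrite letter_k.
apply/eqP; rewrite eqn_leq; apply/andP; split.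
  (* Unless 1 is the last letter, position k + 1 is an ascent, which bounds the first ascent i. *)
  have [lt_Skn|le_nSk] := ltnP k.+1 n.+1; last by rewrite (leq_trans (ltnW lt_in)).
  have /implyP := min_i (Ordinal lt_Skn); apply; rewrite /is_ascent /= lt_Skn /=.
  rewrite letter_k ltn_neqAle -{1}letter_k letter_neq //=.
  exact: letter_gt0.
rewrite ltnNge leq_eqVlt; apply/negP=> /orP[/eqP eq_ik | lt_ik].
  by move: asc_i; rewrite eq_ik letter_k ltnNge letter_gt0.
have := desc i.-1; rewrite prednK // => /(_ lt_ik).
by rewrite ltnNge ltnW.
Qed.

Theorem theorem1p5 (R : comNzRingType) (n : nat) (hn : (1 <= n)%N)
    (x y alpha u1 u2 u3 u4 : R)
    (hsum : x + y = u3 + u4) (hprod : x * y = u1 * u2) :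
  binomial_stirling_eulerian n x y alpha =
  \sum_(s in PRW n.+1)
    (u1 * u2) ^+ peaks s * u3 ^+ da s * u4 ^+ dd s
      * alpha ^+ (LRmin s + RLmin s - 2)%N.
Proof.
have sum_words v3 v4 : \sum_(s in PRW n.+1) (u1 * u2) ^+ peaks s * v3 ^+ da s
      * v4 ^+ dd s * alpha ^+ (LRmin s + RLmin s - 2)%N =
    prw_sum (u1 * u2) v3 v4 alpha n.+2 (iota 2 n).
  rewrite /prw_sum -[_ :: _]/(iota 1 n.+1) -big_words [LHS]big_mkcond.
  apply: eq_bigr => s _ /=; rewrite mem_PRW LRmin_word RLmin_word weight_word.
  by case: prw; rewrite ?mul1r ?mul0r.
have good_iota : good n.+2 (iota 2 n).
  rewrite /good -[path _ _ _]/(sorted ltn (iota 1 n.+1)) iota_ltn_sorted.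
  apply/allP=> i; rewrite mem_iota.
  by case/andP=> _; rewrite add2n.
(* The left-hand side is the case (u3, u4) = (y, x), since x^(dd + M) y^(da + M) = (x y)^M y^da
   x^dd. *)
rewrite sum_words -(@eq_prw_sum _ _ y x) // -?sum_words; last by rewrite addrC.
apply: eq_bigr => s _; rewrite des_word asc_word -hprod !exprD exprMn; ring.
Qed.
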